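(* Let $(X,d)$ be a complete, connected, locally compact, non-compact geodesic space. For any non-empty compact subset $K_0\subset X$: (i) $\mathrm{ep}(K_0)$ is a non-empty subset of $\partial K_0$, where $\partial K_0$ denotes the topological boundary of $K_0$, and $\mathrm{ep}(\mathrm{ep}(K_0))=\mathrm{ep}(K_0)$. (ii) $u_{K_0}=u_{\mathrm{ep}(K_0)}$ on $X$; in other words, $K_0\sim\mathrm{ep}(K_0)$.
   Context: A geodesic space is a length space in which the distance between any two points is attained by the length of some Lipschitz curve connecting them. For a non-empty closed set $H\subseteq X$, $d(x,H)=\inf_{h\in H}d(x,h)$. For a non-empty compact $K_0\subset X$, let $S_r(K_0)=\{x\in X: d(x,K_0)=r\}$ for $r>0$; the $K_0$-assigned dl-function is $u_{K_0}(x)=\lim_{r\to+\infty}[d(x,S_r(K_0))-r]$ (this limit exists for every $x\in X$ and defines a 1-Lipschitz function). A point $x_0\in K_0$ is an exposed point of $K_0$ if $u_{K_0}(x_0)=0$; $\mathrm{ep}(K_0)$ is the set of all exposed points of $K_0$. (It is a closed subset of $K_0$, hence compact, so that $u_{\mathrm{ep}(K_0)}$ and $\mathrm{ep}(\mathrm{ep}(K_0))$ make sense once $\mathrm{ep}(K_0)$ is non-empty.) The relation $\sim$ on non-empty compact sets: $K_0\sim K_1$ if $\rho(K_0,K_1)=0$, where $\rho(K_0,K_1)=-\frac12[\min_{x\in K_1}u_{K_0}(x)+\min_{x\in K_0}u_{K_1}(x)]$. *)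

(* Defs.v *)
From HB Require Import structures.
From mathcomp Require Import all_boot all_order all_algebra.
From mathcomp Require Import all_classical all_reals all_analysis.

Set Implicit Arguments.
Unset Strict Implicit.
Unset Printing Implicit Defensive.

Import Order.TTheory GRing.Theory Num.Theory.
Import numFieldNormedType.Exports.

Local Open Scope classical_set_scope.
Local Open Scope ring_scope.

(* [completeType] bundles completeness with a distinguished point; this is the
   same axiom without the point. *)
Definition complete_space (X : uniformType) : Prop :=
  forall F : set_system X, ProperFilter F -> cauchy F -> exists x : X, F --> x.

Definition boundary (X : topologicalType) (A : set X) : set X :=
  closure A `\` A°.

Section MetricNotions.
Context {R : realType} {X : metricType R}.
Implicit Types (x y : X) (K : set X) (a b r : R) (g : R -> X).

(* Only the values of [g] on [a, b] matter in the next three definitions. *)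
Definition lipschitz_curve a b g : Prop :=
  exists k : R, forall s t, s \in `[a, b] -> t \in `[a, b] ->
    mdist (g s) (g t) <= k * `|s - t|.

(* Metric-valued analogue of [variation]; the partition points are [a :: p]. *)
Definition curve_variation a b g (p : seq R) : R :=
  let G := g \o nth b (a :: p) in
  \sum_(0 <= n < size p) mdist (G n) (G n.+1).

Definition curve_length a b g : \bar R :=
  ereal_sup [set (curve_variation a b g p)%:E | p in itv_partition a b].

Definition connecting_lengths x y : set (\bar R) :=
  [set l | exists a b g, [/\ a <= b, lipschitz_curve a b g,
                             g a = x, g b = y & l = curve_length a b g]].

Definition set_dist x K : R := inf [set mdist x h | h in K].

Definition set_sphere K r : set X := [set x | set_dist x K = r].

Definition dl_fun K x : R :=
  lim ((fun r => set_dist x (set_sphere K r) - r) @ +oo).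

Definition ep K : set X := [set x | K x /\ dl_fun K x = 0].

(* The minima over compact sets are written as infima. *)
Definition dl_rho K K' : R :=
  - (2^-1 * (inf [set dl_fun K x | x in K'] + inf [set dl_fun K' x | x in K])).

Definition dl_equiv K K' : Prop := dl_rho K K' = 0.

End MetricNotions.

Definition length_space (R : realType) (X : metricType R) : Prop :=
  forall x y : X, (mdist x y)%:E = ereal_inf (connecting_lengths x y).

Definition geodesic_space (R : realType) (X : metricType R) : Prop :=
  length_space X /\ forall x y : X, connecting_lengths x y (mdist x y)%:E.

(* Main.v *)
(* Write D(z) = d(z, K).  Along a geodesic from x to a far sphere one crosses
   every nearer sphere, so d(x, S_r(K)) - r is nondecreasing in r once
   r >= D(x), and u_K(x) is its supremum.  On K it is nonnegative, so the
   exposed points are the points of K at distance exactly r from S_r(K) for all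
   r.  The foot in K of a point of S_s(K) has this property for all r <= s,
   hence by compactness it is close to ep(K) when s is large.  This gives
   ep(K) nonempty and d(z, ep(K)) - d(z, K) -> 0 at infinity; as
   u_K(x) = liminf_z (d(x, z) - d(z, K)), the functions u_K and u_ep(K) agree.
   An exposed point is not interior since a geodesic from it to S_1(K) leaves K
   at once.  Spheres are nonempty because X is unbounded, by Hopf-Rinow. *)
Require Import Defs.
From HB Require Import structures.
From mathcomp Require Import all_boot all_order all_algebra.
From mathcomp Require Import all_classical all_reals all_analysis.
From mathcomp Require Import lra.

Set Implicit Arguments.
Unset Strict Implicit.
Unset Printing Implicit Defensive.

Import Order.TTheory GRing.Theory Num.Theory.
Import numFieldNormedType.Exports.

Local Open Scope classical_set_scope.
Local Open Scope ring_scope.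

(** * Geodesics, compact balls and the Hopf-Rinow theorem *)

Section Metric.
Context {R : realType} {X : metricType R}.
Implicit Types (x y z p : X) (K A : set X) (f : X -> R).

(** By symmetry of [mdist], this one-sided bound over all pairs is the 1-Lipschitz condition. *)
Definition nonexpansive f := forall x y, f x <= f y + mdist x y.

Lemma nbhs_mdist x (P : set X) (e : R) :
  0 < e -> (forall y, mdist x y < e -> P y) -> \forall y \near x, P y.
Proof.
by move=> e0 eP; apply/nbhs_ballP; exists e => // y; rewrite ballEmdist => /eP.
Qed.

Lemma nonexpansive_norm f x y : nonexpansive f -> `|f x - f y| <= mdist x y.
Proof.
move=> fl; have := fl x y; have := fl y x; rewrite (metric_sym y x).
by rewrite ler_norml; lra.
Qed.

Lemma nonexpansive_continuous f : nonexpansive f -> continuous f.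
Proof.
move=> fl x; apply/cvgrPdist_lt => e e0; apply: (nbhs_mdist e0) => y xy.
exact: le_lt_trans (nonexpansive_norm x y fl) xy.
Qed.

Lemma nonexpansive_mdistl p : nonexpansive (mdist p).
Proof. by move=> x y; rewrite (metric_sym x y); exact: metric_triangle. Qed.

Definition cball p (r : R) : set X := [set x | mdist p x <= r].

Lemma closed_cball p r : closed (cball p r).
Proof.
rewrite (_ : cball p r = mdist p @^-1` [set t | t <= r])//.
apply: closed_comp; last exact: closed_le.
by move=> x _; apply/nonexpansive_continuous/nonexpansive_mdistl.
Qed.

(** What all later arguments use of geodesics, free of curves and parameters. *)
Definition crossing_property := forall f, nonexpansive f ->
  forall x z r, f x <= r <= f z ->
  exists2 y, f y = r & mdist x y + mdist y z = mdist x z.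

(** The intermediate value theorem applies to [f] along a shortest curve. Cutting that curve at the
    point found gives a variation of at most its length [mdist x z]. *)
Lemma geodesic_crossing : geodesic_space X -> crossing_property.
Proof.
move=> [_ geo] f fl x z r /andP[fxr rfz].
have [a [b [g [ab [k glip] gax gbz lenE]]]] := geo x z.
have : {within `[a, b], continuous (f \o g)}.
  apply/subspace_continuousP => s sab.
  apply/cvgrPdist_le => e e0.
  have k0 : 0 < `|k| + 1 by rewrite ltr_wpDl.
  have d0 : 0 < e / (`|k| + 1) by rewrite divr_gt0.
  near=> t; have tab : t \in `[a, b] by near: t; exact: withinT.
  have st : `|s - t| < e / (`|k| + 1).
    by near: t; apply: cvg_within; exact: (@nbhsx_ballx _ _ s _ d0).
  have gst : mdist (g s) (g t) <= e.
    apply: (le_trans (glip _ _ _ _)) => //.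
    rewrite (@le_trans _ _ ((`|k| + 1) * `|s - t|))//.
      rewrite ler_wpM2r// (le_trans (ler_norm k))// lerDl//.
    by rewrite mulrC -ler_pdivlMr// ltW.
  exact: le_trans (nonexpansive_norm _ _ fl) gst.
move=> /(@IVT _ _ _ _ r ab)[|c cab fgc].
  by rewrite /= gax gbz ge_min le_max fxr rfz orbT.
exists (g c) => //; apply/eqP; rewrite eq_le metric_triangle andbT.
move: cab; rewrite in_itv/= => /andP[].
(* Partitions are strictly increasing, so [c = a] and [c = b] are settled first; there the equality
   is immediate. *)
rewrite [a <= c]le_eqVlt => /predU1P[<- _|ac].
  by rewrite gax mdistxx add0r.
rewrite [c <= b]le_eqVlt => /predU1P[->|cb].
  by rewrite gbz mdistxx addr0.
rewrite -lee_fin lenE; apply: ereal_sup_ubound.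
exists [:: c; b]; first by rewrite /itv_partition /= ac cb.
by rewrite /curve_variation /= big_nat_recr//= big_nat1 gax gbz.
Unshelve. all: by end_near. Qed.

Lemma compact_nbhd K : locally_compact [set: X] -> compact K ->
  exists (e : R) (U : set X),
    [/\ 0 < e, compact U & forall x y, K x -> mdist x y < e -> U y].
Proof.
move=> lcX /compact_near_coveringP cK.
(* Shrinking radii and growing compact sets form a filter, because compact sets
   are stable under finite unions. *)
pose F : set_system (R * set X) :=
  filter_from [set q | 0 < q.1 /\ compact q.2]
    (fun q => [set r | r.1 <= q.1 /\ q.2 `<=` r.2]).
have FF : Filter F.
  apply: filter_from_filter.
    by exists (1, set0); split => //; exact: compact0.
  move=> [d U] [e V] [/= d0 cU] [/= e0 cV].
  exists (Num.min d e, U `|` V).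
    by split; [rewrite lt_min d0 e0|exact: compactU].
  move=> [h W] [/=]; rewrite le_min => /andP[hd he] UVW.
  by split; split => //= x Hx; apply: UVW; [left|right].
pose P (q : R * set X) x := [set y | mdist x y < q.1] `<=` q.2.
have [x Kx|[e U] [e0 cU] eU] := cK _ F P FF.
  have [U] := lcX x I; rewrite withinET => /nbhs_ballP[e /= e0 eU] [cU _].
  have e20 : 0 < e / 2 by rewrite divr_gt0.
  exists ([set y | mdist x y < e / 2], [set q | q.1 <= e / 2 /\ U `<=` q.2]).
    split; first by apply: (nbhs_mdist e20).
    by exists (e / 2, U).
  move=> [y [h V]] [/= xy [he UV]] z /= yz; apply/UV/eU.
  rewrite ballEmdist /=; have := metric_triangle x y z; lra.
exists e, U; split => // x y Kx xy.
by have := eU (e, U) (conj (lexx _) (@subset_refl _ _)) x Kx y xy.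
Qed.

(** Openness step of Hopf-Rinow: a point at distance between [r] and [r + e / 2] from [p] is within
    [e / 2] of a point at distance exactly [r], hence lies in the compact set [U]. *)
Lemma locally_compact_cball p r : locally_compact [set: X] ->
  crossing_property -> 0 <= r -> compact (cball p r) ->
  exists2 s, r < s & compact (cball p s).
Proof.
move=> lcX cross r0 /(compact_nbhd lcX)[e [U [e0 cU eU]]].
exists (r + e / 2); first by rewrite ltrDl divr_gt0.
apply: (@subclosed_compact _ _ U) => //; first exact: closed_cball.
move=> z; rewrite /cball /= => pz.
have [zr|rz] := leP (mdist p z) r.
  by apply: (eU z) => //; rewrite mdistxx.
have [|y py pyz] := cross _ (@nonexpansive_mdistl p) p z r.
  by rewrite mdistxx r0 ltW.
by apply: (eU y); rewrite /cball /= ?py//; move: pyz; rewrite py; lra.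
Qed.

(** Closedness step of Hopf-Rinow. If an ultrafilter on the ball is not Cauchy, then for some [e] it
    contains the complement of every [e]-ball. Compactness of a slightly smaller ball keeps it
    [e / 2] away from that whole ball at once. *)
Lemma complete_cball p r : complete_space X -> crossing_property -> 0 < r ->
  (forall s, s < r -> compact (cball p s)) -> compact (cball p r).
Proof.
move=> Xc cross r0 cpt; rewrite compact_ultra => F FU Fr.
have FP : ProperFilter F by exact: ultra_proper.
suff Fcauchy : cauchy F.
  have [x Fx] := Xc F FP Fcauchy; exists x; split => //.
  by apply: closed_cball => B /Fx FB; exact: filter_ex (filterI Fr FB).
apply/cauchy_exP => e e0; apply: contrapT => /forallNP Fe.
have {}Fe x : F (~` ball x e).
  by case: (in_ultra_setVsetC (ball x e) FU) => // /Fe.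
(* By crossing, every point of the [r]-ball is within [e / 4] of the [s]-ball; the maximum with 0
   keeps [s] a value that [mdist p] takes on the way. *)
pose s := Num.max 0 (r - e / 4).
have sr : s < r by rewrite /s gt_max r0 /=; lra.
have /compact_near_coveringP cov := cpt s sr.
have : \near F, cball p s `<=` [set x | e / 2 < mdist x F].
  have e40 : 0 < e / 4 by rewrite divr_gt0.
  apply: cov => x _; exists ([set y | mdist x y < e / 4], ~` ball x e).
    by split; [apply: nbhs_mdist e40 _|exact: Fe].
  move=> [y i] [/= xy]; rewrite ballEmdist /= => /negP; rewrite -leNgt => xi.
  have := metric_triangle x y i; lra.
move=> /(filterI Fr)/filter_ex[z [pz far]].
have [zs|sz] := leP (mdist p z) s.
  by have /= := far z zs; rewrite mdistxx; lra.
have [|y py pyz] := cross _ (@nonexpansive_mdistl p) p z s.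
  by rewrite mdistxx (ltW sz) andbT le_max lexx.
have /= : e / 2 < mdist y z by apply: far; rewrite /cball /= py.
have : r - e / 4 <= s by rewrite /s le_max lexx orbT.
move: pyz pz; rewrite /cball /= py; lra.
Qed.

(** Otherwise the radii of compact balls have a finite supremum; the closedness step makes it such a
    radius, and the openness step exceeds it. *)
Lemma proper_cball p r : complete_space X -> locally_compact [set: X] ->
  crossing_property -> compact (cball p r).
Proof.
move=> Xc lcX cross; apply: contrapT => ncr.
pose S := [set s | 0 <= s /\ compact (cball p s)].
have cballS s t : s <= t -> compact (cball p t) -> compact (cball p s).
  move=> st ct; apply: (@subclosed_compact _ _ (cball p t)) => //.
    exact: closed_cball.
  move=> x; rewrite /cball /=.
  by move=> /le_trans; exact.
have S0 : S 0.
  split => //; apply: (@subclosed_compact _ _ [set p]).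
  - exact: closed_cball.
  - exact: compact_set1.
  - move=> x; rewrite /cball /= => px; apply/esym/mdist_positivity/eqP.
  by rewrite eq_le px mdist_ge0.
have supS : has_sup S.
  split; first by exists 0.
  exists r => s [_ cs]; rewrite leNgt; apply/negP => /ltW rs.
  exact: ncr (cballS _ _ rs cs).
have sup0 : 0 <= sup S by exact: sup_upper_bound.
have below s : s < sup S -> compact (cball p s).
  move=> ssup; have d0 : 0 < sup S - s by rewrite subr_gt0.
  have [t [_ ct]] := sup_adherent d0 supS.
  by rewrite subKr => /ltW st; exact: cballS ct.
have csup : compact (cball p (sup S)).
  move: sup0; rewrite le_eqVlt => /predU1P[<-|sup0]; first by case: S0.
  exact: complete_cball.
have [s ss cs] := locally_compact_cball lcX cross sup0 csup.
have : s <= sup S by apply: sup_upper_bound => //; split => //; lra.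
by rewrite leNgt ss.
Qed.

Lemma noncompact_unbounded : complete_space X -> locally_compact [set: X] ->
  crossing_property -> ~ compact [set: X] ->
  forall p r, exists z, r < mdist p z.
Proof.
move=> Xc lcX cross ncX p r; apply: contrapT => /forallNP bnd; apply: ncX.
rewrite (_ : [set: X] = cball p r); first exact: proper_cball.
by apply/seteqP; split => // z _; rewrite /cball /= leNgt; apply/negP/bnd.
Qed.

End Metric.

(** * Distance to a set *)

Section SetDist.
Context {R : realType} {X : metricType R}.
Implicit Types (x y z p : X) (K A : set X) (f : X -> R).

Lemma set_dist_has_inf x A : A !=set0 -> has_inf [set mdist x h | h in A].
Proof.
move=> [a Aa]; split; first by exists (mdist x a), a.
by exists 0 => _ [h _ <-]; exact: mdist_ge0.
Qed.

Lemma set_dist_le x A a : A a -> set_dist x A <= mdist x a.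
Proof.
move=> Aa; apply: ge_inf; last by exists a.
by apply: (set_dist_has_inf x _).2; exists a.
Qed.

Lemma set_dist_ge x A c : A !=set0 -> (forall a, A a -> c <= mdist x a) ->
  c <= set_dist x A.
Proof.
move=> [a Aa] cA; apply: lb_le_inf; first by exists (mdist x a), a.
by move=> _ [h Ah <-]; exact: cA.
Qed.

Lemma nonexpansive_set_dist A : A !=set0 -> nonexpansive (set_dist^~ A).
Proof.
move=> A0 x y; rewrite -lerBlDr; apply: set_dist_ge => // a Aa.
by rewrite lerBlDl (le_trans (set_dist_le x Aa))// metric_triangle.
Qed.

Lemma set_dist_eq0 x A : A x -> set_dist x A = 0.
Proof.
move=> Ax; apply/eqP; rewrite eq_le -{1}(mdistxx x) set_dist_le//=.
by apply: set_dist_ge; [exists x|move=> *; exact: mdist_ge0].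
Qed.

Lemma set_dist_attained x K : K !=set0 -> compact K ->
  exists2 h, K h & set_dist x K = mdist x h.
Proof.
move=> K0 cK.
have [|h Kh hmin] := @compact_EVT_min X R (mdist x) K K0 cK.
  exact/continuous_subspaceT/nonexpansive_continuous/nonexpansive_mdistl.
rewrite inE in Kh; exists h => //; apply/eqP; rewrite eq_le set_dist_le//=.
by apply: set_dist_ge => // a Ka; apply: hmin; rewrite inE.
Qed.

Lemma compact_mdist_bounded x K : K !=set0 -> compact K ->
  exists2 C : R, 0 <= C & forall h, K h -> mdist x h <= C.
Proof.
move=> K0 cK.
have [|h Kh hmax] := @compact_EVT_max X R (mdist x) K K0 cK.
  exact/continuous_subspaceT/nonexpansive_continuous/nonexpansive_mdistl.
by exists (mdist x h); [exact: mdist_ge0|move=> a Ka; apply: hmax; rewrite inE].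
Qed.

End SetDist.

(** * Spheres around a compact set and the limit defining the dl-function *)

Section DlFun.
Context {R : realType} {X : metricType R}.
Context (Xcross : @crossing_property R X).
Context (Xunbounded : forall (p : X) (r : R), exists z, r < mdist p z).
Implicit Types (x y z p : X) (K A : set X) (f : X -> R).

Definition pre_dl K x (r : R) : R := set_dist x (set_sphere K r) - r.

Section Compact.
Context (K : set X).
Context (K0 : K !=set0) (cK : compact K).

Lemma set_sphere_neq0 r : 0 <= r -> set_sphere K r !=set0.
Proof.
move=> r0; have [h Kh] := K0.
have [C C0 KC] := compact_mdist_bounded h K0 cK.
(* [K] lies within [C] of [h], so [z] is at distance at least [r] from [K]. *)
have [z hz] := Xunbounded h (C + r).
have [|y yr _] :=
    Xcross (nonexpansive_set_dist K0) (x := h) (z := z) (r := r);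
  last by exists y.
rewrite set_dist_eq0// r0; apply: set_dist_ge => // a Ka.
have := metric_triangle h a z; have := KC _ Ka; rewrite (metric_sym a); lra.
Qed.

Lemma pre_dl_le x r z : set_dist z K = r -> pre_dl K x r <= mdist x z - r.
Proof. by move=> zr; rewrite lerB// set_dist_le. Qed.

Lemma pre_dl_ge x r c : 0 <= r ->
  (forall z, set_dist z K = r -> c <= mdist x z - r) -> c <= pre_dl K x r.
Proof.
move=> r0 cz; rewrite lerBrDr; apply: set_dist_ge; first exact: set_sphere_neq0.
by move=> z /cz; rewrite lerBrDr.
Qed.

Lemma nonexpansive_pre_dl r : 0 <= r -> nonexpansive (pre_dl K ^~ r).
Proof.
move=> r0 x y; have := nonexpansive_set_dist (set_sphere_neq0 r0) x y.
by rewrite /pre_dl; lra.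
Qed.

Lemma set_dist_ge0 x : 0 <= set_dist x K.
Proof. by apply: set_dist_ge => // *; exact: mdist_ge0. Qed.

(* A geodesic from [x] to the farther sphere crosses the nearer one. *)
Lemma pre_dl_homo x r s : set_dist x K <= r -> r <= s ->
  pre_dl K x r <= pre_dl K x s.
Proof.
move=> xr rs; have r0 := le_trans (set_dist_ge0 x) xr.
apply: pre_dl_ge => [|z zs]; first exact: le_trans rs.
have [|y yr xyz] :=
  Xcross (nonexpansive_set_dist K0) (x := x) (z := z) (r := r).
  by rewrite xr zs.
have := nonexpansive_set_dist K0 z y; rewrite zs yr metric_sym.
have := pre_dl_le x yr; lra.
Qed.

Lemma pre_dl_bounded x : exists C, forall r, 0 <= r -> pre_dl K x r <= C.
Proof.
have [C _ KC] := compact_mdist_bounded x K0 cK.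
exists C => r r0; have [z zr] := set_sphere_neq0 r0.
have [h Kh zh] := set_dist_attained z K0 cK.
have := pre_dl_le x zr; have := metric_triangle x h z; have := KC _ Kh.
by rewrite (metric_sym h) -zh zr; lra.
Qed.

Lemma is_cvg_pre_dl x : cvg (pre_dl K x @ +oo).
Proof.
(* Monotonicity holds only from [set_dist x K] on; freezing the function below that value makes it
   monotone on the whole line without changing the limit. *)
pose f r := pre_dl K x (Num.max r (set_dist x K)).
have ndf : nondecreasing_fun f.
  move=> r s rs; apply: pre_dl_homo; first by rewrite le_max lexx orbT.
  by rewrite ge_max !le_max rs lexx orbT.
have [C fC] := pre_dl_bounded x.
have fC' : has_ubound (range f).
  by exists C => _ [r _ <-]; apply: fC; rewrite le_max set_dist_ge0 orbT.
apply/cvg_ex; exists (sup (range f)).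
apply: cvg_trans (nondecreasing_cvgr ndf fC').
apply: near_eq_cvg; by near=> r; rewrite /f (max_idPl _).
Unshelve. all: by end_near. Qed.

Lemma pre_dl_le_dl_fun x r : set_dist x K <= r -> pre_dl K x r <= dl_fun K x.
Proof.
move=> xr; apply: limr_ge; first exact: is_cvg_pre_dl.
near=> s; exact: pre_dl_homo.
Unshelve. all: by end_near. Qed.

Lemma dl_fun_le x r0 c : (forall r, r0 <= r -> pre_dl K x r <= c) ->
  dl_fun K x <= c.
Proof.
move=> fc; apply: limr_le; first exact: is_cvg_pre_dl.
near=> s; apply: fc.
by near: s; apply: nbhs_pinfty_ge; exact: num_real.
Unshelve. all: by end_near. Qed.

Lemma nonexpansive_dl_fun : nonexpansive (dl_fun K).
Proof.
move=> x y; apply: (@dl_fun_le _ (set_dist y K)) => r yr.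
have r0 := le_trans (set_dist_ge0 y) yr.
apply: le_trans (nonexpansive_pre_dl r0 x y) _.
by rewrite lerD2r pre_dl_le_dl_fun.
Qed.

(** * Exposed points of a compact set *)

Lemma dl_fun_ge0 x : K x -> 0 <= dl_fun K x.
Proof.
move=> Kx; apply: le_trans (pre_dl_le_dl_fun (lexx _)).
rewrite set_dist_eq0//; apply: pre_dl_ge => // z _.
by rewrite subr0 mdist_ge0.
Qed.

Lemma not_ep x : K x -> ~ ep K x -> exists2 r, 0 <= r & 0 < pre_dl K x r.
Proof.
move=> Kx nx; apply: contrapT => H; apply: nx; split=> //.
apply/eqP; rewrite eq_le dl_fun_ge0// andbT.
apply: (@dl_fun_le _ 0) => r r0; rewrite leNgt; apply/negP => fr.
by apply: H; exists r.
Qed.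

Lemma ep_pre_dl x r : ep K x -> 0 <= r -> pre_dl K x r <= 0.
Proof.
move=> [Kx ux0] r0; have := @pre_dl_le_dl_fun x r.
by rewrite set_dist_eq0// ux0; exact.
Qed.

Lemma compact_ep : compact (ep K).
Proof.
apply: (@subclosed_compact _ _ K) => //; last by move=> x [].
rewrite (_ : ep K = K `&` dl_fun K @^-1` [set t | t = 0])//.
apply: closedI; first by apply: compact_closed => //; exact: metric_hausdorff.
apply: closed_comp; last exact: closed_eq.
by move=> x _; apply/nonexpansive_continuous/nonexpansive_dl_fun.
Qed.

(* The foot in [K] of a far away point has vanishing [pre_dl] on all smaller
   spheres, so by compactness it is close to an exposed point. *)
Lemma ep_near_foot (e : R) : 0 < e ->
  \forall s \near +oo, forall z, set_dist z K = s ->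
    exists2 x, ep K x & mdist z x <= s + e.
Proof.
move=> e0; have /compact_near_coveringP/near_covering_withinP cov := cK.
have : \forall s \near +oo, K `<=` [set x |
    0 < pre_dl K x s \/ exists2 y, ep K y & mdist x y <= e].
  apply: cov => x Kx.
  have [epx|/(not_ep Kx)[r r0 fr]] := pselect (ep K x).
    exists ([set y | mdist x y < e], setT).
      by split; [apply: nbhs_mdist e0 _|exact: filterT].
    move=> [y s] [/= xy _] _; right; exists x => //.
    by rewrite metric_sym ltW.
  (* Positivity of [pre_dl K x r] spreads to this ball because [pre_dl] is nonexpansive in the
     point, and to all larger radii by monotonicity. *)
  exists ([set y | mdist x y < pre_dl K x r], [set s | r <= s]).
    split; first by apply: nbhs_mdist fr _.
    by apply: nbhs_pinfty_ge; exact: num_real.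
  move=> [y s] [/= xy rs] Ky; left.
  apply: lt_le_trans (pre_dl_homo _ rs); last by rewrite set_dist_eq0.
  by have := nonexpansive_pre_dl r0 x y; lra.
move=> near_ep; near=> s => z zs.
have [h Kh zh] := set_dist_attained z K0 cK.
have near_eps : K `<=` [set x |
    0 < pre_dl K x s \/ exists2 y, ep K y & mdist x y <= e].
  by near: s.
have [|[y epy hy]] := near_eps h Kh.
  by have := pre_dl_le h zs; rewrite metric_sym -zh zs; lra.
exists y => //; apply: le_trans (metric_triangle z h y) _.
by rewrite -zh zs lerD2l.
Unshelve. all: by end_near. Qed.

Lemma ep_neq0 : ep K !=set0.
Proof.
near (+oo : set_system R) => s.
have [|z zs] := @set_sphere_neq0 s.
  by near: s; apply: nbhs_pinfty_ge; exact: num_real.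
have foot : forall z, set_dist z K = s ->
    exists2 x, ep K x & mdist z x <= s + 1.
  by near: s; exact: ep_near_foot.
by have [x epx _] := foot z zs; exists x.
Unshelve. all: by end_near. Qed.

Lemma ep_subset_boundary : ep K `<=` boundary K.
Proof.
move=> x epx; have [Kx _] := epx; split; first exact: subset_closure.
rewrite /interior => /nbhs_ballP[e /= e0 eK].
(* The bound [e / 2] keeps the crossing point [y] in [K], and [1 <= mdist x z] ensures that level
   [t] is crossed. As [mdist x z < 1 + t], the point [y] of [K] is closer than 1 to [z]. *)
pose t := Num.min (e / 2) 1.
have t0 : 0 < t by rewrite lt_min ltr01 andbT divr_gt0.
have te : t <= e / 2 by rewrite ge_min lexx.
have t1 : t <= 1 by rewrite ge_min lexx orbT.
have [_ [z z1 <-]] :=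
  inf_adherent t0 (set_dist_has_inf x (set_sphere_neq0 ler01)).
have := ep_pre_dl epx ler01; rewrite /pre_dl /set_dist => x1 xz.
have z1x := set_dist_le z Kx.
have [|y xy xyz] :=
  Xcross (@nonexpansive_mdistl _ _ x) (x := x) (z := z) (r := t).
  by rewrite mdistxx (ltW t0) (le_trans t1)// -z1 metric_sym.
have Ky : K y by apply: eK; rewrite ballEmdist /= xy; lra.
have := set_dist_le z Ky; rewrite z1 metric_sym; lra.
Qed.

End Compact.

(** * Comparison of a compact set with its exposed points *)

Section Ep.
Context (K : set X).
Context (K0 : K !=set0) (cK : compact K).
Let epK0 : ep K !=set0 := ep_neq0 K0 cK.
Let cepK : compact (ep K) := compact_ep K0 cK.

Let set_dist_ep_ge x : set_dist x K <= set_dist x (ep K).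
Proof. by apply: set_dist_ge => // a [Ka _]; exact: set_dist_le. Qed.

(** Since [ep K] lies in [K], a point of the [r]-sphere of [K] is on a sphere of [ep K] of radius at
    least [r]; monotonicity compares the two. *)
Lemma dl_fun_ep_le x : dl_fun (ep K) x <= dl_fun K x.
Proof.
apply: (dl_fun_le epK0 cepK (r0 := set_dist x (ep K))) => r xr.
have xKr := le_trans (set_dist_ep_ge x) xr.
apply: le_trans (pre_dl_le_dl_fun K0 cK xKr).
have r0 : 0 <= r := le_trans (set_dist_ge0 K0 x) xKr.
apply: pre_dl_ge => // z zr.
have rz : r <= set_dist z (ep K) by rewrite -zr.
apply: (le_trans (pre_dl_homo epK0 cepK xr rz)).
by apply: le_trans (pre_dl_le x erefl) _; rewrite lerB.
Qed.

(** Far away, the distances to [K] and to [ep K] differ by at most [e], so distant spheres of [ep K]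
    bound [pre_dl K x] up to [e]. *)
Lemma dl_fun_le_ep x : dl_fun K x <= dl_fun (ep K) x.
Proof.
apply/ler_addgt0Pr => e e0.
have [a epa] := epK0.
have [C C0 KC] := compact_mdist_bounded a K0 cK.
have [s0 [_ near_foot]] := ep_near_foot K0 cK e0.
(* The foot estimate holds strictly beyond [s0], hence the [+ 1]. *)
apply: (dl_fun_le K0 cK (r0 := Num.max (s0 + 1) (set_dist x K))) => s.
rewrite ge_max => /andP[s0s xs].
have s_ge0 := le_trans (set_dist_ge0 K0 x) xs.
have xE0 := set_dist_ge0 epK0 x.
(* In this radius, [C] forces [s <= set_dist z K] on the sphere, and the last summand puts it in the
   range where [pre_dl] lies below its limit. *)
rewrite -lerBlDr; apply: le_trans (pre_dl_le_dl_fun epK0 cepK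
  (r := s + C + set_dist x (ep K)) _); last by rewrite lerDr addr_ge0.
apply: pre_dl_ge => // [|z zr]; first by rewrite !addr_ge0.
have [h Kh zh] := set_dist_attained z K0 cK.
have sz : s <= set_dist z K.
  have := metric_triangle z h a; have := set_dist_le z epa; have := KC h Kh.
  by rewrite (metric_sym h a) zr -zh; lra.
have [||y epy zy] := near_foot (set_dist z K) _ z; [by lra|by []|].
have := pre_dl_homo K0 cK xs sz; have := pre_dl_le x (erefl (set_dist z K)).
have := set_dist_le z epy; rewrite zr; lra.
Qed.

Lemma dl_fun_ep x : dl_fun K x = dl_fun (ep K) x.
Proof. by apply/eqP; rewrite eq_le dl_fun_le_ep dl_fun_ep_le. Qed.

Lemma ep_ep : ep (ep K) = ep K.
Proof.
apply/seteqP; split => x [] //.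
by move=> Kx ux0; split => //; rewrite -dl_fun_ep.
Qed.

(** Taken with [A = K] and [A = ep K], this evaluates both minima in [dl_rho]: the lower bound 0 on
    [K] is attained at any exposed point. *)
Lemma inf_dl_fun A : ep K `<=` A -> A `<=` K ->
  inf [set dl_fun K x | x in A] = 0.
Proof.
move=> epA AK; have [a epa] := epK0; have [_ ua0] := epa.
have A0 : [set dl_fun K x | x in A] 0 by exists a => //; exact: epA.
have lb0 : lbound [set dl_fun K x | x in A] 0.
  by move=> _ [y /AK Ky <-]; exact: dl_fun_ge0.
apply/eqP; rewrite eq_le lb_le_inf ?andbT; [|by exists 0|by []].
by apply: ge_inf => //; exists 0.
Qed.

Lemma dl_equiv_ep : dl_equiv K (ep K).
Proof.
have epK : ep K `<=` K by move=> x [].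
rewrite /dl_equiv /dl_rho -(funext dl_fun_ep) !inf_dl_fun//.
by rewrite addr0 mulr0 oppr0.
Qed.

End Ep.
End DlFun.

Unset Implicit Arguments.

Theorem theorem1p11 (R : realType) (X : metricType R)
  (Xcomplete : complete_space X)
  (Xconnected : connected [set: X])
  (Xloccompact : locally_compact [set: X])
  (Xnoncompact : ~ compact [set: X])
  (Xgeodesic : geodesic_space X)
  (K0 : set X) (K0neq0 : K0 !=set0) (K0compact : compact K0) :
  (ep K0 !=set0 /\ ep K0 `<=` boundary K0 /\ ep (ep K0) = ep K0) /\
  ((forall x : X, dl_fun K0 x = dl_fun (ep K0) x) /\ dl_equiv K0 (ep K0)).
Proof.
have cross := geodesic_crossing Xgeodesic.
have unb := noncompact_unbounded Xcomplete Xloccompact cross Xnoncompact.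
split; split; [exact: ep_neq0| |exact: dl_fun_ep|exact: dl_equiv_ep].
by split; [exact: ep_subset_boundary|exact: ep_ep].
Qed.
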